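(* Let $n\geq 2$ and $r\geq 3$ be integers, and let $S_1,S_r$ be positive real numbers satisfying $S_r\leq S_1^r\leq n^{r-1}S_r$. Let $x_1,\dots,x_n\geq 0$ be real numbers with $x_1+\cdots+x_n=S_1$ and $x_1^r+\cdots+x_n^r=S_r$, and let $E=\sum_{1\leq i<j\leq n}(x_i-x_j)^2$. Then \[ E\geq (n-1)S_1^2\alpha^2, \] where $\alpha$ is the root in $[0,1)$ of the equation $(1+\alpha(n-1))^r+(n-1)(1-\alpha)^r=n^rS_rS_1^{-r}$. Conversely, letting $\beta$ be the non-negative root of $(n-1)S_1^2\beta^2=E$, we have \[ S_r\leq \bigl((1+\beta(n-1))^r+(n-1)(1-\beta)^r\bigr)\frac{S_1^r}{n^r}. \]
   Context: $E$ is called the potential energy of $x_1,\dots,x_n$.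
   Formalization: When S_r = S_1^r the equation's only root in [0,1] is α = 1, so no root in [0,1) exists; existence and uniqueness of α is therefore stated only for S_r < S_1^r, while the energy bound is stated for every root in [0,1). *)

(* Defs.v *)
From mathcomp Require Import all_boot all_order all_algebra.

Set Implicit Arguments.
Unset Strict Implicit.
Unset Printing Implicit Defensive.

Import Order.TTheory GRing.Theory Num.Theory.
Local Open Scope ring_scope.

Definition potential_energy (R : pzRingType) (n : nat) (x : 'I_n -> R) : R :=
  \sum_(i < n) \sum_(j < n | (i < j)%N) (x i - x j) ^+ 2.

(* Main.v *)
(** Fix the sum and the sum of squares of nonnegative [x_i]. With a suitable
    [b], the numbers [z_i = x_i - b] satisfy [sum z_i = s] and
    [sum z_i^2 = s^2], hence all [x_i] lie below [a = b + s]. The quadratic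
    interpolating [t^r] at the nodes [b, b, a] dominates [t^r] on [[0, a]],
    since the error is [(t - b)^2 (t - a)] times a divided difference of [t^r],
    which is nonnegative. Summing over the [x_i], the quadratic contributes
    exactly [a^r + (n - 1) b^r], which is the bound in terms of [beta]. The
    bound on the energy follows because
    [(1 + alpha (n - 1))^r + (n - 1) (1 - alpha)^r] is increasing. *)
Require Import Defs.
From mathcomp Require Import all_boot all_order all_algebra.
From mathcomp Require Import reals.
From mathcomp Require Import ring lra.
Import Order.TTheory GRing.Theory Num.Theory.
Local Open Scope ring_scope.

(** Doubling the energy gives the sum over all ordered pairs, the diagonal being zero; expanding the
    squares then separates the variables. *)
Lemma potential_energyE (R : numDomainType) (n : nat) (x : 'I_n -> R) :
  potential_energy x
    = n%:R * (\sum_(i < n) x i ^+ 2) - (\sum_(i < n) x i) ^+ 2.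
Proof.
apply: (@mulfI _ 2%:R); first by rewrite pnatr_eq0.
have swap : potential_energy x
    = \sum_(i < n) \sum_(j < n | (j < i)%N) (x i - x j) ^+ 2.
  rewrite /potential_energy (exchange_big_dep predT) //=.
  by apply: eq_bigr => i _; apply: eq_bigr => j _; rewrite -sqrrN opprB.
have full : 2%:R * potential_energy x
    = \sum_(i < n) \sum_(j < n) (x i - x j) ^+ 2.
  rewrite mulr_natl mulr2n {2}swap /potential_energy -big_split /=.
  apply: eq_bigr => i _.
  rewrite [RHS](bigID (fun j : 'I_n => (i < j)%N)) /=; congr (_ + _).
  rewrite [RHS](bigD1 i) ?ltnn //= subrr expr0n add0r.
  by apply: eq_bigl => j; rewrite -leqNgt ltn_neqAle andbC.
rewrite {}full.
set S := \sum_(i < n) x i; set Q := \sum_(i < n) x i ^+ 2.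
have inner i : \sum_(j < n) (x i - x j) ^+ 2
    = n%:R * x i ^+ 2 + (- 2 * S) * x i + Q.
  under eq_bigr => j _ do rewrite sqrrB.
  rewrite big_split sumrB /= sumr_const card_ord sumrMnl -/Q -mulr_sumr -/S.
  by rewrite -[_ ^+ 2 *+ n]mulr_natl; ring.
under eq_bigr => i _ do rewrite inner.
rewrite !big_split /= -!mulr_sumr sumr_const card_ord -/S -/Q -mulr_natl.
by ring.
Qed.

(* Newton interpolation of [t^r]: the coefficients are its divided differences
   at the nodes [b, b, a, t]. *)
Lemma exprn_newton (R : realDomainType) (a b : R) (r : nat) :
  0 <= a -> 0 <= b ->
  exists p0 p1 p2 (g : R -> R),
    [/\ [/\ 0 <= p0, 0 <= p1 & 0 <= p2], forall t, 0 <= t -> 0 <= g t &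
        forall t, t ^+ r = p0 + p1 * (t - b) + p2 * (t - b) ^+ 2
                             + g t * ((t - a) * (t - b) ^+ 2)].
Proof.
move=> a0 b0; elim: r => [|r [p0 [p1 [p2 [g [[p00 p10 p20] g0 E]]]]]].
  by exists 1, 0, 0, (fun=> 0); split=> // t; rewrite expr0; ring.
(* Multiply by [t], written as [b + (t - b)] in the first two terms and as [a + (t - a)] in the
   third. *)
exists (b * p0), (p0 + b * p1), (p1 + a * p2), (fun t => t * g t + p2); split.
- by split; rewrite ?addr_ge0 ?mulr_ge0.
- by move=> t t0; rewrite addr_ge0 ?mulr_ge0 ?g0.
- by move=> t; rewrite exprS E; ring.
Qed.

Lemma sum_exprn_le (R : realDomainType) (n r : nat) (x : 'I_n -> R) (b s : R) :
  (forall i, 0 <= x i) -> 0 <= b -> 0 <= s ->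
  \sum_(i < n) (x i - b) = s -> \sum_(i < n) (x i - b) ^+ 2 = s ^+ 2 ->
  \sum_(i < n) x i ^+ r <= (b + s) ^+ r + (n%:R - 1) * b ^+ r.
Proof.
move=> x0 b0 s0 sum1 sum2.
(* One square is at most the whole sum of squares [s ^+ 2]. *)
have xle i : x i <= b + s.
  rewrite -lerBlDl; apply: le_trans (ler_norm _) _.
  rewrite -(@ler_pXn2r _ 2) ?nnegrE // real_normK ?num_real // -sum2.
  by rewrite (bigD1 i) //= lerDl sumr_ge0 // => j _; rewrite sqr_ge0.
have [p0 [p1 [p2 [g [_ g0 E]]]]] := @exprn_newton _ _ _ r (addr_ge0 b0 s0) b0.
apply: (@le_trans _ _
    (\sum_(i < n) (p0 + p1 * (x i - b) + p2 * (x i - b) ^+ 2))).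
  apply: ler_sum => i _; rewrite E gerDl mulr_ge0_le0 ?g0 //.
  by rewrite mulr_le0_ge0 ?sqr_ge0 // subr_le0.
rewrite !big_split /= -!mulr_sumr sum1 sum2 sumr_const card_ord -mulr_natl.
(* The error term vanishes at both nodes, where the quadratic takes the values
   [p0 + p1 * s + p2 * s ^+ 2] and [p0]. *)
by rewrite (E (b + s)) (E b); lra.
Qed.

(** Mean value bound without derivatives: the slope of [t ^+ r] is at least [r] beyond 1. *)
Lemma exprn_sub_ge (R : realDomainType) (u v : R) (r : nat) :
  1 <= u -> u <= v -> r%:R * (v - u) <= v ^+ r - u ^+ r.
Proof.
move=> u1 uv; elim: r => [|r IH]; first by rewrite !expr0 subrr mul0r.
have ur : 1 <= u ^+ r by rewrite exprn_ege1.
have vu : 0 <= r%:R * (v - u) by rewrite mulr_ge0 ?subr_ge0.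
rewrite !exprS -natr1; set c := r%:R in IH vu *; nra.
Qed.

Lemma exprn_sub_gt (R : realDomainType) (u v : R) (r : nat) :
  (2 <= r)%N -> 1 <= u -> u < v -> r%:R * (v - u) < v ^+ r - u ^+ r.
Proof.
case: r => // r r1 u1 uv.
have IH := @exprn_sub_ge _ u v r u1 (ltW uv).
have ur : 1 <= u ^+ r by rewrite exprn_ege1.
have vu : 0 < r%:R * (v - u) by rewrite mulr_gt0 ?subr_gt0 ?ltr0n.
rewrite !exprS -natr1; set c := r%:R in IH vu *; nra.
Qed.

Lemma exprn_sub_le (R : realDomainType) (u v : R) (r : nat) :
  0 <= u -> u <= v -> v <= 1 -> v ^+ r - u ^+ r <= r%:R * (v - u).
Proof.
move=> u0 uv v1; elim: r => [|r IH]; first by rewrite !expr0 subrr mul0r.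
have ur : u ^+ r <= 1 by rewrite exprn_ile1 // (le_trans uv).
have ur0 : 0 <= u ^+ r by rewrite exprn_ge0.
have vur : u ^+ r <= v ^+ r by rewrite lerXn2r ?nnegrE ?(le_trans u0).
rewrite !exprS -natr1; set c := r%:R in IH *; nra.
Qed.

(** From [a] to [b] the first power gains more than [r * m * (b - a)], while the second term loses
    at most that. *)
Lemma two_value_power_sum_lt (R : realDomainType) (m : R) (r : nat) (a b : R) :
  0 < m -> (2 <= r)%N -> 0 <= a -> a < b -> b <= 1 ->
  (1 + a * m) ^+ r + m * (1 - a) ^+ r < (1 + b * m) ^+ r + m * (1 - b) ^+ r.
Proof.
move=> m0 r2 a0 ab b1.
have A : r%:R * ((1 + b * m) - (1 + a * m)) < (1 + b * m) ^+ r - (1 + a * m) ^+ r.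
  by apply: exprn_sub_gt => //; nra.
have B : (1 - a) ^+ r - (1 - b) ^+ r <= r%:R * ((1 - a) - (1 - b)).
  by apply: exprn_sub_le; lra.
move: A B; set c := r%:R; nra.
Qed.

Lemma two_value_power_sum_root (R : rcfType) (m y : R) (r : nat) :
  (0 < r)%N -> 1 + m <= y -> y <= (1 + m) ^+ r ->
  exists2 a, 0 <= a <= 1 & (1 + a * m) ^+ r + m * (1 - a) ^+ r = y.
Proof.
move=> r0 y0 y1.
pose p : {poly R} := (1 + m *: 'X) ^+ r + m *: (1 - 'X) ^+ r - y%:P.
have pE a : p.[a] = (1 + a * m) ^+ r + m * (1 - a) ^+ r - y.
  by rewrite /p !hornerE (mulrC m).
have [||a a01 /rootP pa] := @poly_ivt _ p 0 1; first exact: ler01.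
  rewrite !pE; apply/andP; split.
    by rewrite mul0r addr0 subr0 !expr1n mulr1 subr_le0.
  by rewrite mul1r subrr expr0n gtn_eqF // mulr0 addr0 subr_ge0.
by exists a => //; apply/eqP; rewrite -subr_eq0 -pE pa.
Qed.

Theorem theorem1p3 (R : realType) (n r : nat) (hn : (2 <= n)%N) (hr : (3 <= r)%N)
    (S1 Sr : R) (hS1 : 0 < S1) (hSr : 0 < Sr)
    (hle1 : Sr <= S1 ^+ r) (hle2 : S1 ^+ r <= n%:R ^+ (r - 1)%N * Sr)
    (x : 'I_n -> R) (hx : forall i, 0 <= x i)
    (hsum1 : \sum_(i < n) x i = S1) (hsumr : \sum_(i < n) x i ^+ r = Sr) :
  (* the root [alpha] in [0, 1) is well defined, and bounds the energy *)
  ((Sr < S1 ^+ r ->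
      exists! alpha : R, 0 <= alpha < 1 /\
        (1 + alpha * (n%:R - 1)) ^+ r + (n%:R - 1) * (1 - alpha) ^+ r
          = n%:R ^+ r * Sr * S1 ^- r) /\
   (forall alpha : R, 0 <= alpha < 1 ->
      (1 + alpha * (n%:R - 1)) ^+ r + (n%:R - 1) * (1 - alpha) ^+ r
        = n%:R ^+ r * Sr * S1 ^- r ->
      (n%:R - 1) * S1 ^+ 2 * alpha ^+ 2 <= potential_energy x)) /\
  (* the non-negative root [beta] is well defined, and bounds [Sr] *)
  ((exists! beta : R, 0 <= beta /\
      (n%:R - 1) * S1 ^+ 2 * beta ^+ 2 = potential_energy x) /\
   (forall beta : R, 0 <= beta ->
      (n%:R - 1) * S1 ^+ 2 * beta ^+ 2 = potential_energy x ->
      Sr <= ((1 + beta * (n%:R - 1)) ^+ r + (n%:R - 1) * (1 - beta) ^+ r)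
              * (S1 ^+ r / n%:R ^+ r))).
Proof.
have n0 : 0 < n%:R :> R by rewrite ltr0n (leq_trans _ hn).
have n2 : 2 <= n%:R :> R by rewrite ler_nat.
have m0 : 0 < n%:R - 1 :> R by lra.
have r2 : (2 <= r)%N by exact: leq_trans hr.
have r0 : (0 < r)%N by exact: leq_trans hr.
have xS i : x i <= S1.
  by rewrite -hsum1 (bigD1 i) //= lerDl sumr_ge0.
have QS : \sum_(i < n) x i ^+ 2 <= S1 ^+ 2.
  rewrite expr2 -{2}hsum1 mulr_sumr; apply: ler_sum => i _.
  by rewrite expr2 ler_wpM2r.
have energy := potential_energyE R n x; rewrite hsum1 in energy.
have mS : 0 < (n%:R - 1) * S1 ^+ 2 by rewrite mulr_gt0 ?exprn_gt0.
have E0 : 0 <= potential_energy x.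
  by do 2![apply: sumr_ge0 => ? _]; rewrite sqr_ge0.
(* This keeps the lower node [S1 / n * (1 - beta)] nonnegative. *)
have beta_le1 beta : 0 <= beta ->
    (n%:R - 1) * S1 ^+ 2 * beta ^+ 2 = potential_energy x -> beta <= 1.
  move=> b0 bE; rewrite -(@ler_pXn2r _ 2) ?nnegrE ?ler01 // expr1n.
  rewrite -(ler_pM2l mS) bE energy; nra.
have Sr_le beta : 0 <= beta ->
    (n%:R - 1) * S1 ^+ 2 * beta ^+ 2 = potential_energy x ->
    Sr <= ((1 + beta * (n%:R - 1)) ^+ r + (n%:R - 1) * (1 - beta) ^+ r)
            * (S1 ^+ r / n%:R ^+ r).
  move=> b0 bE; have b1 := beta_le1 _ b0 bE.
  have nn0 : n%:R != 0 :> R by rewrite gt_eqF.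
  have c0 : 0 <= S1 / n%:R by rewrite divr_ge0 // ltW.
  (* The nodes are the two values of a configuration with sum [S1] and energy [E]: one entry
     [b + s], all others [b]. *)
  have := @sum_exprn_le R n r x (S1 / n%:R * (1 - beta)) (S1 * beta) hx.
  rewrite hsumr; set c := _ / _ => main.
  have cn : S1 = n%:R * c by rewrite /c; field.
  have -> : S1 ^+ r / n%:R ^+ r = c ^+ r by rewrite -expr_div_n.
  rewrite mulrDl -mulrA -!exprMn.
  rewrite (mulrC (1 - beta)).
  have -> : (1 + beta * (n%:R - 1)) * c = c * (1 - beta) + S1 * beta.
    by rewrite cn; ring.
  apply: main.
  - by rewrite mulr_ge0 // subr_ge0.
  - by rewrite mulr_ge0 // ltW.
  - by rewrite sumrB hsum1 sumr_const card_ord -mulr_natl cn; ring.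
  - under eq_bigr => i _ do rewrite sqrrB.
    rewrite big_split sumrB /= sumrMnl -mulr_suml hsum1 sumr_const card_ord.
    have /(canRL (mulKf nn0)) -> : n%:R * \sum_(i < n) x i ^+ 2
        = (n%:R - 1) * S1 ^+ 2 * beta ^+ 2 + S1 ^+ 2 by rewrite bE energy; ring.
    by rewrite -[_ ^+ 2 *+ n]mulr_natl cn; field.
have beta_ex : exists2 beta, 0 <= beta &
    (n%:R - 1) * S1 ^+ 2 * beta ^+ 2 = potential_energy x.
  exists (Num.sqrt (potential_energy x / ((n%:R - 1) * S1 ^+ 2))).
    exact: sqrtr_ge0.
  rewrite sqr_sqrtr ?divr_ge0 ?(ltW mS) //.
  by rewrite mulrC divfK // gt_eqF.
have rhsK z : n%:R ^+ r * (z * (S1 ^+ r / n%:R ^+ r)) * S1 ^- r = z.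
  have nr : n%:R ^+ r != 0 :> R by rewrite expf_neq0 ?gt_eqF.
  have sr : S1 ^+ r != 0 by rewrite expf_neq0 ?gt_eqF.
  by move: nr sr; set A := n%:R ^+ r; set B := S1 ^+ r => *; field; apply/andP.
have nr0 : 0 < n%:R ^+ r :> R by rewrite exprn_gt0.
have Sr0 : 0 < S1 ^+ r by rewrite exprn_gt0.
split; split; [| |case: beta_ex => beta b0 bE|exact: Sr_le].
(* Strictness matters: if [Sr = S1 ^+ r], the only root in [[0, 1]] is 1. *)
- move=> Srlt.
  have [||a /andP[a0 a1] aE] := @two_value_power_sum_root R (n%:R - 1)
      (n%:R ^+ r * Sr * S1 ^- r) r r0.
  (* The end values are [n] and [n ^ r], so the two range conditions are [hle2] and [hle1]. *)
  + rewrite addrC subrK ler_pdivlMr //.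
    rewrite -[in leRHS](prednK r0) exprS -mulrA ler_pM2l //.
    by rewrite -subn1.
  + by rewrite addrC subrK ler_pdivrMr // ler_pM2l.
  have a1' : a < 1.
    rewrite lt_neqAle a1 andbT; apply/eqP => a_eq1.
    move: aE; rewrite a_eq1 mul1r subrr expr0n gtn_eqF // mulr0 addr0.
    rewrite addrC subrK => /eqP.
    by rewrite gt_eqF // ltr_pdivrMr // ltr_pM2l.
  exists a; split; first by rewrite a0 a1'.
  move=> a' [/andP[a'0 a'1] a'E].
  have [lt|lt|//] := ltgtP a a'.
    have := @two_value_power_sum_lt R _ r _ _ m0 r2 a0 lt (ltW a'1).
    by rewrite aE a'E ltxx.
  have := @two_value_power_sum_lt R _ r _ _ m0 r2 a'0 lt a1.
  by rewrite aE a'E ltxx.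
- move=> a /andP[a0 a1] aE; case: beta_ex => beta b0 bE.
  have b1 := beta_le1 _ b0 bE.
  suff ab : a <= beta by rewrite -bE ler_pM2l // lerXn2r ?nnegrE.
  (* If [beta < a], strict monotonicity would put the left side of the equation at [beta] below its
     right side, against [Sr_le]. *)
  rewrite leNgt; apply/negP => lt.
  have := @two_value_power_sum_lt R _ r _ _ m0 r2 b0 lt (ltW a1).
  rewrite aE ltNge => /negP; apply.
  rewrite -[leRHS]rhsK ler_pM2r ?invr_gt0 // ler_pM2l //.
  exact: Sr_le.
- exists beta; split=> // beta' [b'0 b'E].
  apply/eqP; rewrite -(@eqrXn2 _ 2) //; apply/eqP/(mulfI (lt0r_neq0 mS)).
  by rewrite bE b'E.
Qed.
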